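(* In the free group $\mathbb{F}_2$, there exists a subsemigroup $\Lambda^+$ such that $$\liminf_{n\to\infty}\frac{|B_n\cap\Lambda^+|}{|B_n|}=0\quad\text{and}\quad \limsup_{n\to\infty}\frac{|B_n\cap\Lambda^+|}{|B_n|}>0.$$
   Context: $\mathbb{F}_2=\langle a,b\rangle$ is the free group on two generators, and $B_n$ is the ball of radius $n$ around the identity for the word distance associated to the generating set $\{a,a^{-1},b,b^{-1}\}$; $|A|$ denotes the cardinality of a finite set $A$. *)

(* Defs.v *)
From HB Require Import structures.
From mathcomp Require Import all_boot all_order all_algebra.
From mathcomp Require Import finmap.
From mathcomp Require Import all_classical all_reals all_analysis.

Set Implicit Arguments.
Unset Strict Implicit.
Unset Printing Implicit Defensive.

Local Open Scope group_scope.

(** * Free group on T: reduced words in the letters t and t^-1, for t : T.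
    The letter (t, true) stands for t, and (t, false) for t^-1. *)

Section ReducedWords.
Variable T : choiceType.

Definition letter : Type := T * bool.
HB.instance Definition _ := Choice.on letter.

Implicit Types (x y : letter) (u v w : seq letter).

Definition linv x : letter := (x.1, ~~ x.2).

Definition reduced w : bool := sorted (fun x y => y != linv x) w.

(* The reduced form of x :: w, for w reduced. *)
Definition push x w : seq letter :=
  if w is y :: w' then if y == linv x then w' else x :: w else [:: x].

Definition wmul u v : seq letter := foldr push v u.

Definition winv u : seq letter := rev (map linv u).

Lemma linvK : involutive linv.
Proof. by case=> t e; rewrite /linv negbK. Qed.

Lemma reduced_cons x w : reduced (x :: w) -> reduced w.
Proof. exact: path_sorted. Qed.

Lemma push_reduced x w : reduced w -> reduced (push x w).
Proof.
case: w => //= y w rw; case: eqVneq => [_|yx]; first exact: path_sorted rw.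
by rewrite /reduced /= yx.
Qed.

Lemma push_id x w : reduced (x :: w) -> push x w = x :: w.
Proof. by case: w => //= y w /andP[/negPf->]. Qed.

Lemma pushK x w : reduced w -> push x (push (linv x) w) = w.
Proof.
case: w => [|y w] /=; first by rewrite eqxx.
rewrite linvK; case: (eqVneq y x) => [->|_ _] /=; last by rewrite eqxx.
exact: push_id.
Qed.

Lemma wmul_reduced u v : reduced v -> reduced (wmul u v).
Proof. by move=> rv; elim: u => //= x u; exact: push_reduced. Qed.

Lemma wmul_push x u v : reduced v -> wmul (push x u) v = push x (wmul u v).
Proof.
move=> rv; case: u => [|y u] //=; case: eqVneq => [->|//].
by rewrite pushK// wmul_reduced.
Qed.

Lemma wmulA u v w : reduced w -> wmul u (wmul v w) = wmul (wmul u v) w.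
Proof. by move=> rw; elim: u => //= x u ->; rewrite wmul_push. Qed.

Lemma wmul0 u : reduced u -> wmul u [::] = u.
Proof.
elim: u => // x u IHu ru; rewrite /wmul /= -/(wmul _ _).
by rewrite IHu ?push_id//; exact: reduced_cons ru.
Qed.

Lemma winv_reduced u : reduced u -> reduced (winv u).
Proof.
rewrite /reduced /winv rev_sorted sorted_map.
apply: sub_sorted => x y /=; rewrite linvK.
by apply: contra => /eqP->.
Qed.

Lemma winvK : involutive winv.
Proof.
by move=> u; rewrite /winv map_rev revK -map_comp map_id_in// => x _ /=;
  rewrite linvK.
Qed.

Lemma wmulVw u : wmul (winv u) u = [::].
Proof.
elim: u => // x u IHu.
by rewrite /winv /= rev_cons /wmul foldr_rcons /= linvK eqxx.
Qed.

End ReducedWords.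

Record free_group (T : choiceType) :=
  FreeGroup { fgval :> seq (letter T); fgvalP : reduced fgval }.

HB.instance Definition _ (T : choiceType) := [isSub for @fgval T].
HB.instance Definition _ (T : choiceType) := [Choice of free_group T by <:].

Section FreeGroup.
Variable T : choiceType.
Implicit Types g h : free_group T.

Definition fg_one : free_group T := @FreeGroup T [::] isT.
Definition fg_mul g h : free_group T :=
  FreeGroup (wmul_reduced (fgval g) (fgvalP h)).
Definition fg_inv g : free_group T := FreeGroup (winv_reduced (fgvalP g)).

Lemma fg_mulA : associative fg_mul.
Proof. by move=> g h k; apply/val_inj; exact: wmulA (fgvalP k). Qed.

Lemma fg_mul1 : left_id fg_one fg_mul.
Proof. by move=> g; exact/val_inj. Qed.

Lemma fg_mulr1 : right_id fg_one fg_mul.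
Proof. by move=> g; apply/val_inj; exact: wmul0 (fgvalP g). Qed.

Lemma fg_mulV : left_inverse fg_one fg_inv fg_mul.
Proof. by move=> g; apply/val_inj; exact: wmulVw. Qed.

Lemma fg_mulrV : right_inverse fg_one fg_inv fg_mul.
Proof.
by move=> g; apply/val_inj; rewrite /= -[X in wmul X _](winvK (fgval g)) wmulVw.
Qed.

HB.instance Definition _ := isGroup.Build (free_group T)
  fg_mulA fg_mul1 fg_mulr1 fg_mulV fg_mulrV.

Definition fgen (t : T) : free_group T := @FreeGroup T [:: (t, true)] isT.

Definition fletter (x : letter T) : free_group T :=
  if x.2 then fgen x.1 else (fgen x.1)^-1.

Lemma fletterE x : fletter x = [:: x] :> seq _.
Proof. by case: x => t []. Qed.

Lemma fg_prodE g : g = \prod_(x <- fgval g) fletter x.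
Proof.
case: g => w rw /=; apply/val_inj => /=.
elim: w rw => [|x w IHw] rw; first by rewrite big_nil.
have rw' := reduced_cons rw.
rewrite big_cons /= fletterE /wmul /=.
by rewrite -IHw// push_id.
Qed.

(* Universal property. *)
Lemma free_group_universal (G : groupType) (f : T -> G) :
  exists2 F : free_group T -> G,
    {morph F : g h / g * h} /\ (forall t, F (fgen t) = f t) &
    forall F' : free_group T -> G, {morph F' : g h / g * h} ->
      (forall t, F' (fgen t) = f t) -> F' =1 F.
Proof.
pose e (x : letter T) := if x.2 then f x.1 else (f x.1)^-1.
have eV x : e (linv x) = (e x)^-1 by case: x => t []; rewrite /e /= ?invgK.
pose F (w : seq (letter T)) := \prod_(x <- w) e x.
have Fpush x w : F (push x w) = e x * F w.
  rewrite /F; case: w => [|y w] /=; first by rewrite big_seq1 big_nil mulg1.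
  case: eqVneq => [->|_]; last by rewrite big_cons.
  by rewrite big_cons eV mulgA mulgV mul1g.
have Fmul u v : F (wmul u v) = F u * F v.
  elim: u => [|x u IHu]; first by rewrite /F big_nil mul1g.
  by rewrite /= Fpush IHu mulgA /F big_cons.
exists (fun g => F (fgval g)).
  by split=> [g h|t]; [exact: Fmul | rewrite /F big_seq1].
move=> F' F'M F'f g.
have F'1 : F' 1 = 1 by apply: (mulgI (F' 1)); rewrite -F'M !mulg1.
have F'V h : F' h^-1 = (F' h)^-1.
  by apply: (mulgI (F' h)); rewrite -F'M !mulgV F'1.
rewrite [in LHS](fg_prodE g) (big_morph F' F'M F'1).
by apply: eq_bigr => -[t []] _; rewrite /fletter /e /= ?F'V F'f.
Qed.

End FreeGroup.

Definition F2 : Type := free_group bool.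
HB.instance Definition _ := Group.on F2.

Definition F2_a : F2 := fgen true.
Definition F2_b : F2 := fgen false.

Local Open Scope classical_set_scope.

Section WordDistance.
Variable G : groupType.
Implicit Types (S A : set G) (g x y : G) (k n : nat).

Definition is_word S k g : Prop :=
  exists s : seq G, [/\ size s = k, forall x, x \in s -> S x
                      & g = \prod_(x <- s) x].

(* S generates G as a monoid; equivalent to generating it as a group when S is
   symmetric. *)
Definition generates S : Prop := forall g, exists k, is_word S k g.

Lemma word_dist_subproof S (genS : generates S) x y :
  exists k, `[< is_word S k (x^-1 * y) >].
Proof. by have [k Sk] := genS (x^-1 * y); exists k; apply/asboolP. Qed.

Definition word_dist S (genS : generates S) x y : nat :=
  ex_minn (word_dist_subproof genS x y).

Definition word_ball S (genS : generates S) x n : set G :=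
  [set y | word_dist genS x y <= n]%N.

Definition is_subsemigroup A : Prop :=
  A !=set0 /\ forall x y, A x -> A y -> A (x * y).

End WordDistance.

Definition F2_gens : set F2 := [set F2_a; F2_a^-1; F2_b; F2_b^-1].

Lemma fletter_F2_gens (x : letter bool) : F2_gens (fletter x : F2).
Proof.
case: x => [[] []]; first by do 3 left.
- by left; left; right.
- by left; right.
- by right.
Qed.

Lemma F2_gens_generates : generates F2_gens.
Proof.
move=> g; exists (size (fgval g)), (map (@fletter bool) (fgval g)).
split; first by rewrite size_map.
  by move=> _ /mapP[x _ ->]; exact: fletter_F2_gens.
by rewrite big_map; exact: fg_prodE.
Qed.

Definition F2_ball (n : nat) : set F2 := word_ball F2_gens_generates 1 n.

Lemma F2_ball_sizeE n : F2_ball n = [set g | size (fgval g) <= n]%N.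
Proof.
have size_push x (w : seq (letter bool)) : (size (push x w) <= (size w).+1)%N.
  by case: w => //= y w; case: ifP => //= _; apply/leqW/leqW.
have size_mul (u v : seq (letter bool)) : (size (wmul u v) <= size u + size v)%N.
  elim: u => //= x u IHu; exact: leq_trans (size_push _ _) _.
apply/seteqP; split=> g; rewrite /F2_ball /word_ball /= /word_dist;
  case: ex_minnP => k /asboolP[s]; rewrite invg1 mul1g => -[sk sS gs] kmin.
  apply: leq_trans; rewrite gs -sk => {g gs k sk kmin}.
  elim: s sS => [|x s IHs] sS; first by rewrite big_nil.
  rewrite big_cons; apply: leq_trans (size_mul _ _) _ => /=.
  rewrite -add1n leq_add//; last by apply: IHs => y ys; apply: sS; rewrite inE ys orbT.
  have : F2_gens x by apply: sS; rewrite mem_head.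
  by case=> [[[]|]|] ->.
move=> gn; apply: leq_trans gn; apply: kmin; apply/asboolP.
exists (map (@fletter bool) (fgval g)); split; first by rewrite size_map.
  by move=> _ /mapP[x _ ->]; exact: fletter_F2_gens.
by rewrite big_map; exact: fg_prodE.
Qed.

(* #|` fset_set A | is the cardinality of A when A is finite, and 0 otherwise;
   it is applied to subsets of F2_ball n. *)
Lemma F2_ball_finite n : finite_set (F2_ball n).
Proof.
rewrite F2_ball_sizeE.
have fin : finite_set [set w : seq (bool * bool) | size w <= n]%N.
  apply: (@sub_finite_set _ _ (\bigcup_(k in `I_n.+1)
     ((fun t : k.-tuple (bool * bool) => tval t) @` setT))).
    by move=> w /= wn; exists (size w) => //; exists (in_tuple w).
  by apply: bigcup_finite => [|k _]; [exact: finite_II |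
     apply: finite_image; exact: finite_finset].
apply: (@finite_preimage _ _ _ (@fgval bool) _ fin).
by move=> g h _ _; exact: val_inj.
Qed.

(* Main.v *)
(** Call a block a reduced word that starts with [a], ends with [b], and whose
    length lies in a sparse set [L = {n_0 < n_1 < ...}].  Blocks concatenate
    without cancellation, so lengths add up in the semigroup they generate, and
    its elements of length [< n_{j+1}] only use blocks of length [<= n_j].
    Such an element has a letter [a] in every window of [n_j] letters.  Any
    nonempty suffix has an extension by [n_j] letters violating this, so these
    words are negligible in the balls of large radius, and [n_{j+1}] is chosen
    just after a radius where their density is at most [1 / n_j].  The blocks
    of length [n_j] alone have density at least [1 / 54] in the ball of radius
    [n_j]. *)

Require Import Defs.
From HB Require Import structures.
From mathcomp Require Import all_boot all_order all_algebra.
From mathcomp Require Import finmap.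
From mathcomp Require Import all_classical all_reals all_analysis.
From mathcomp Require Import zify.

Import Order.TTheory GRing.Theory Num.Theory.

Local Open Scope classical_set_scope.
Local Open Scope ring_scope.

Arguments reduced : simpl never.

(** * Enumeration of reduced words; sizes of spheres and balls *)

Section ReducedWordLists.
Local Open Scope nat_scope.

Notation word := (seq (letter bool)).
Implicit Types (x : letter bool) (u v w : word) (k m n : nat).

(* The letters [a] and [b]. *)
Notation letA := ((true, true) : letter bool).
Notation letB := ((false, true) : letter bool).

Definition letters : seq (letter bool) :=
  [:: (true, true); (true, false); (false, true); (false, false)].

Lemma mem_letters x : x \in letters.
Proof. by case: x => [[] []]. Qed.

Definition extend1 w : seq word :=
  [seq x :: w | x <- letters & reduced (x :: w)].

(* All reduced words [u ++ w] with [size u = k], for [w] reduced. *)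
Fixpoint extend k w : seq word :=
  if k is k'.+1 then flatten [seq extend1 v | v <- extend k' w] else [:: w].

Lemma mem_extend1 x v w :
  (x :: v \in extend1 w) = (v == w) && reduced (x :: w).
Proof.
apply/mapP/andP => [[y]|[/eqP-> rxw]].
  by rewrite mem_filter => /andP[ryw _] [-> ->].
by exists x; rewrite // mem_filter rxw mem_letters.
Qed.

(** The equation with [take k v] expresses that [w] is a suffix of [v] without an existential
    quantifier. *)
Lemma mem_extend k w v : reduced w ->
  (v \in extend k w) = reduced v && (v == take k v ++ w) && (size v == k + size w).
Proof.
move=> rw; elim: k v => [|k IHk] v /=.
  rewrite take0 inE /= add0n; case: (eqVneq v w) => [->|]; last by rewrite andbF.
  by rewrite rw eqxx.
case: v => [|x v].
  by rewrite andbF; apply/negP => /flatten_mapP[v _]; case/mapP.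
rewrite /= eqseq_cons eqxx /= addSn eqSS.
apply/flatten_mapP/idP => [[u]|].
  rewrite IHk mem_extend1 => /andP[/andP[_ uE] su] /andP[/eqP-> rxu].
  by rewrite rxu su andbT.
move=> /andP[/andP[rxv vE] sv]; exists v; first by rewrite IHk vE sv (reduced_cons rxv).
by rewrite mem_extend1 eqxx.
Qed.

Lemma uniq_extend k w : uniq (extend k w).
Proof.
elim: k => //= k IHk; rewrite -(map_id (extend k w)).
elim: (extend k w) IHk => //= v s IHs /andP[vs us].
rewrite cat_uniq IHs// andbT; apply/andP; split.
  by rewrite map_inj_uniq ?filter_uniq// => x y [].
apply/hasPn => u; rewrite map_id => /flatten_mapP[v' v's].
case: u => [|x u]; first by case/mapP.
rewrite !mem_extend1 => /andP[/eqP uv' _].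
by apply: contra vs => /andP[/eqP <- _]; rewrite uv'.
Qed.

Lemma size_extend1 x w : reduced (x :: w) -> size (extend1 (x :: w)) = 3.
Proof.
move=> rw; rewrite size_map size_filter.
by case: x rw => [[] []] /= rw; rewrite /reduced /= in rw *; rewrite rw.
Qed.

Lemma size_extend k x w : reduced (x :: w) -> size (extend k (x :: w)) = 3 ^ k.
Proof.
move=> rw; elim: k => //= k IHk.
rewrite size_flatten /shape -map_comp sumnE big_map (eq_big_seq (fun=> 3)).
  by rewrite big_const_seq count_predT iter_addn_0 IHk expnS.
move=> v /=; rewrite mem_extend// => /andP[/andP[rv _]]; case: v rv => [_ |y v ryv _].
  by rewrite /= addnS.
exact: size_extend1.
Qed.

Lemma extendD k m w :
  extend (k + m) w = flatten [seq extend k v | v <- extend m w].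
Proof.
elim: k => [|k IHk]; first by elim: (extend m w) => //= v s {1}->.
rewrite addSn /= IHk; elim: (extend m w) => //= v s <-.
by rewrite map_cat flatten_cat.
Qed.

Definition ball_words n : seq word :=
  flatten [seq extend i [::] | i <- iota 0 n.+1].

Lemma mem_ball_words n w : (w \in ball_words n) = reduced w && (size w <= n).
Proof.
apply/flatten_mapP/andP => [[i]|[rw wn]].
  rewrite mem_iota mem_extend// => /= ilt /andP[/andP[-> _] /eqP->].
  by rewrite addn0 -ltnS.
by exists (size w); rewrite ?mem_iota ?mem_extend// rw take_size cats0 addn0 !eqxx.
Qed.

Lemma uniq_ball_words n : uniq (ball_words n).
Proof.
rewrite /ball_words; elim: (iota _ _) (iota_uniq 0 n.+1) => //= i s IHs /andP[si us].
rewrite cat_uniq uniq_extend IHs// andbT; apply/hasPn => w /flatten_mapP[j js].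
rewrite !mem_extend// => /andP[_ /eqP->]; apply/negP => /andP[_ /eqP].
by rewrite !addn0 => ji; rewrite -ji js in si.
Qed.

(** The empty word has four one-letter extensions, every other reduced word has three. *)
Lemma size_sphere n : size (extend n.+1 [::]) = 4 * 3 ^ n.
Proof.
by rewrite -addn1 extendD /= !size_cat !size_extend//= addn0 !addnA; lia.
Qed.

Lemma count_ball_words (P : pred word) n :
  count P (ball_words n) = \sum_(i < n.+1) count P (extend i [::]).
Proof.
rewrite /ball_words count_flatten sumnE -map_comp big_map.
by rewrite -[iota 0 n.+1]/(index_iota 0 n.+1) big_mkord.
Qed.

Lemma size_ball_words n : (size (ball_words n)).+1 = 2 * 3 ^ n.
Proof.
rewrite -count_predT; elim: n => [|n IHn]; first by [].
move: IHn; rewrite !count_ball_words big_ord_recr /= [in X in _ -> X]big_ord_recr /=.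
rewrite big_ord_recr !count_predT /=.
rewrite -[flatten _]/(extend n.+1 [::]) size_sphere expnS; lia.
Qed.

(** * Words with an [a] in every window of [k] letters, and their density *)

Arguments extend : simpl never.

Definition good_word k w : bool :=
  [forall i : 'I_(size w).+1, (i + k <= size w) ==> (letA \in take k (drop i w))].

Lemma good_wordP k w :
  reflect (forall i, i + k <= size w -> letA \in take k (drop i w)) (good_word k w).
Proof.
apply: (iffP forallP) => [H i ik|H i]; last exact/implyP/H.
have iw : i < (size w).+1 by rewrite ltnS (leq_trans _ ik)// leq_addr.
by have /implyP/(_ ik) := H (Ordinal iw).
Qed.

Lemma good_word_cat k v w : good_word k (v ++ w) -> good_word k w.
Proof.
move=> /good_wordP H; apply/good_wordP => i ik.
have := H (size v + i); rewrite size_cat -addnA leq_add2l => /(_ ik).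
by rewrite drop_cat ltnNge leq_addr /= addKn.
Qed.

(* A letter [b] or [b^-1] that does not cancel with [x]. *)
Definition b_before x : letter bool := (false, x.1 || x.2).

Lemma reduced_b_before x w : reduced (x :: w) -> reduced (b_before x :: x :: w).
Proof. by rewrite /reduced /= => ->; rewrite andbT; case: x => [[] []]. Qed.

(** Prepending [k] copies of one letter b or b^-1 makes the first window free of [a]. *)
Lemma bad_extension k x w : 0 < k -> reduced (x :: w) ->
  exists2 v, v \in extend k (x :: w) & ~~ good_word k v.
Proof.
move=> k0 rxw.
exists (nseq k (b_before x) ++ x :: w).
  rewrite mem_extend// take_size_cat ?size_nseq// size_cat size_nseq !eqxx !andbT.
  elim: k {k0} => // -[|k] IHk; first exact: reduced_b_before.
  by move: IHk; rewrite /reduced /= => ->; case: x {rxw} => [[] []].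
apply/negP => /good_wordP/(_ 0); rewrite size_cat size_nseq leq_addr => /(_ isT).
by rewrite drop0 take_size_cat ?size_nseq// mem_nseq andbF.
Qed.

(** Suffixes of good words are good, so a bad word has no good extension; a good one has at least
    one bad extension among its 3^k. *)
Lemma count_good_extend k x w : 0 < k -> reduced (x :: w) ->
  count (good_word k) (extend k (x :: w)) <= (3 ^ k).-1 * good_word k (x :: w).
Proof.
move=> k0 rxw; case: (boolP (good_word k (x :: w))) => [_|/negP bw]; last first.
  rewrite muln0 leqn0 -leqn0 leqNgt -has_count; apply/hasPn => v.
  rewrite mem_extend// => /andP[/andP[_ /eqP->] _].
  by apply/negP => /good_word_cat.
have [v vE bv] := bad_extension k x w k0 rxw.
rewrite muln1 -ltnS prednK ?expn_gt0// -(size_extend k x w rxw).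
rewrite -(count_predC (good_word k)) -addn1 leq_add2l -has_count.
by apply/hasP; exists v.
Qed.

Lemma count_good_sphere k n : 0 < k -> 0 < n ->
  count (good_word k) (extend (k + n) [::])
    <= (3 ^ k).-1 * count (good_word k) (extend n [::]).
Proof.
move=> k0 n0; rewrite extendD count_flatten sumnE -map_comp big_map.
rewrite -sum1_count [in leqRHS]big_mkcond /= big_distrr /= big_seq [leqRHS]big_seq.
apply: leq_sum => v; rewrite mem_extend// => /andP[/andP[rv _] /eqP].
case: v rv => [_ /=|x v rxv _]; last exact: count_good_extend.
by rewrite addn0 => nE; rewrite -nE in n0.
Qed.

(** Spheres of radius above [k] are compared with those [k] steps further in; the remaining ones lie
    in the ball of radius [k]. *)
Lemma count_good_ball k n : 0 < k ->
  count (good_word k) (ball_words (k + n))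
    <= (3 ^ k).-1 * count (good_word k) (ball_words n) + size (ball_words k).
Proof.
move=> k0; rewrite -(count_predT (ball_words k)) !count_ball_words -addSn.
rewrite big_split_ord /= addnC leq_add//.
  rewrite [in leqRHS]big_ord_recl mulnDr big_distrr.
  apply: leq_trans (leq_addl _ _); apply: leq_sum => i _.
  by rewrite addSnnS; exact: count_good_sphere.
by apply: leq_sum => i _; rewrite count_predT count_size.
Qed.

(** Bernoulli's inequality 1 + j/p <= (1 + 1/p)^j, cleared of denominators. *)
Lemma exp_succ_lower p j : p ^ j * (p + j) <= p * p.+1 ^ j.
Proof.
elim: j => [|j IHj]; first by rewrite !expn0; lia.
rewrite !expnS.
have : p.+1 * (p ^ j * (p + j)) <= p.+1 * (p * p.+1 ^ j) by rewrite leq_mul2l IHj orbT.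
nia.
Qed.

Lemma good_ball_sparse k c : 0 < k ->
  exists2 n, k <= n & c * count (good_word k) (ball_words n) <= 3 ^ n.
Proof.
move=> k0; set p := (3 ^ k).-1; set d := size (ball_words k).
have pE : 3 ^ k = p.+1 by rewrite prednK// expn_gt0.
have p2 : 1 < p by rewrite -ltnS -pE; case: k k0 {p d pE} => // k _; rewrite expnS; lia.
(* Adding [d] on the left turns the affine recursion x' <= p x + d into a geometric one, because p
   >= 2. *)
have bound j : count (good_word k) (ball_words (j * k)) + d <= p ^ j * d.+1.
  elim: j => [|j IHj].
    rewrite expn0 mul1n -add1n leq_add2r mul0n.
    exact: count_size.
  have := count_good_ball k (j * k) k0; rewrite -mulSn -/p -/d expnS.
  nia.
(* With j = p e, Bernoulli gives p^j (e + 1) <= (p + 1)^j = 3^(j k); the choice of [e] lets e + 1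
   absorb the factor c (d + 1). *)
exists (p * (c * d.+1).+1 * k).
  by rewrite leq_pmull// muln_gt0; lia.
set e := (c * d.+1).+1; set j := p * e.
have p_le : p ^ j * e.+1 <= p.+1 ^ j.
  have := exp_succ_lower p j; rewrite {2}/j -mulnS mulnCA leq_pmul2l//.
  by lia.
rewrite mulnC [j * k]mulnC [3 ^ (k * _)]expnM pE (leq_trans _ p_le)//.
have := bound j; rewrite [j * k]mulnC => bj.
have := leq_mul (leq_trans (leq_addr _ _) bj) (leqnn c).
by move=> /leq_trans; apply; rewrite -mulnA leq_mul2l /e mulnC; lia.
Qed.

(** * Blocks and the semigroup they generate *)

Section Blocks.
Variable L : pred nat.

(** The defaults of [head] and [last] are the wrong letters, so the empty word is not a block. *)
Definition block w : bool :=
  [&& reduced w, head letB w == letA, last letA w == letB & L (size w)].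

Lemma block_neq0 w : block w -> w != [::].
Proof. by case: w => // /and3P[_ /eqP]. Qed.

Lemma reduced_cat v w : reduced v -> last letA v = letB ->
  reduced w -> head letB w = letA -> reduced (v ++ w).
Proof.
case: v => [|x v] //; case: w => [|y w]; first by rewrite cats0.
by rewrite /reduced /= cat_path => -> -> /= -> ->.
Qed.

Lemma wmul_cat v w : reduced (v ++ w) -> wmul v w = v ++ w.
Proof.
elim: v => // x v IHv rvw.
by rewrite -[wmul _ _]/(push x (wmul v w)) IHv ?push_id// (reduced_cons rvw).
Qed.

Lemma flatten_blocks s : s != [::] -> all block s ->
  [/\ reduced (flatten s), head letB (flatten s) = letA
    & last letA (flatten s) = letB].
Proof.
elim: s => // u s IHs _ /= /andP[bu bs].
have u0 := block_neq0 _ bu; case/and4P: (bu) => ru /eqP hu /eqP lu _.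
have [s0|/IHs/(_ bs)[rs hs ls]] := eqVneq s [::]; first by rewrite s0 cats0.
split; first exact: reduced_cat.
  by case: u u0 {bu ru lu} hu.
by rewrite last_cat lu; case: (flatten s) ls hs.
Qed.

Definition block_semigroup : set F2 :=
  [set g | exists s, [/\ s != [::], all block s & fgval g = flatten s]].

Lemma block_semigroup_mul g h : block_semigroup g -> block_semigroup h ->
  block_semigroup (g * h)%g.
Proof.
move=> [s [s0 bs gs]] [t [t0 bt ht]]; exists (s ++ t); split.
- by case: s s0 {bs gs}.
- by rewrite all_cat bs.
- have [rs hs ls] := flatten_blocks s s0 bs.
  have [rt h_t lt] := flatten_blocks t t0 bt.
  rewrite -[fgval _]/(wmul (fgval g) (fgval h)) gs ht flatten_cat.
  by apply: wmul_cat; exact: reduced_cat.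
Qed.

(** Each block starts with [a] and has at most [k] letters, so a window of [k] letters starts at the
    head of a block or reaches the head of the next one. *)
Lemma flatten_blocks_good k (s : seq word) :
  0 < k -> {in s, forall u, size u <= k} -> all block s -> good_word k (flatten s).
Proof.
move=> k0 sk bs; apply/good_wordP => i.
elim: s i sk bs => [|u s IHs] i sk /=.
  by rewrite leqNgt addn_gt0 k0 orbT.
move=> /andP[bu bs]; rewrite size_cat => ik.
have uk : size u <= k by apply: sk; rewrite mem_head.
have {}sk : {in s, forall u, size u <= k} by move=> v vs; apply: sk; rewrite inE vs orbT.
have := block_neq0 _ bu; case/and4P: bu => _ /eqP hu _ _.
rewrite drop_cat; case: ltnP => iu u0; last by apply: IHs => //; lia.
case: i iu ik => [|i] iu ik.
  by rewrite drop0; case: u u0 hu {uk iu ik} => //= y u _ ->;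
    case: k k0 {sk IHs} => // k _; rewrite /= mem_head.
(* A window starting after the head of the last block would overrun the word. *)
have s0 : s != [::] by apply/eqP => s0; rewrite s0 /= in ik; lia.
have [_ + _] := flatten_blocks s s0 bs.
case: (flatten s) => //= y w ->.
rewrite take_cat size_drop ifF; last by apply/negbTE; lia.
rewrite mem_cat orbC; have : 0 < k - (size u - i.+1) by lia.
by case: (k - _) => //= m _; rewrite mem_head.
Qed.

Lemma many_blocks n : L n.+3 ->
  exists l : seq word, [/\ uniq l, size l = 3 ^ n,
    all block l & all (fun w => size w == n.+3) l].
Proof.
move=> Ln.
(* The buffer letter b or b^-1 cancels neither with [a] nor with the head of [w], so each of the 3^n
   reduced words of length n + 1 ending in [b] yields a block. *)
pose f w := letA :: b_before (head letB w) :: w.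
have rf w : reduced w -> reduced (f w).
  by case: w => // x w /reduced_b_before.
have blk w : w \in extend n [:: letB] -> block (f w) && (size (f w) == n.+3).
  rewrite mem_extend// => /andP[/andP[rw /eqP wE] /eqP sw].
  have sf : size (f w) = n.+3 by rewrite /= sw addn1.
  by rewrite /block sf Ln rf// eqxx /= !andbT wE last_cat.
exists (map f (extend n [:: letB])); split.
- by rewrite map_inj_uniq ?uniq_extend// => v w [].
- by rewrite size_map size_extend.
- by apply/allP => _ /mapP[w /blk/andP[bw _] ->].
- by apply/allP => _ /mapP[w /blk/andP[_ sw] ->].
Qed.

End Blocks.

(** * Cardinalities of sets of group elements via lists of words *)

Lemma card_fset_set_le (A : set F2) (l : seq word) : finite_set A ->
  (forall g, A g -> fgval g \in l) -> #|` fset_set A| <= size l.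
Proof.
move=> finA Al; rewrite -(size_map (@fgval bool)) uniq_leq_size//.
  by rewrite map_inj_uniq ?fset_uniq//; exact: val_inj.
by move=> _ /mapP[g gA ->]; apply: Al; move: gA; rewrite in_fset_set// inE.
Qed.

Lemma card_fset_set_ge (A : set F2) (l : seq word) : finite_set A -> uniq l ->
  (forall w, w \in l -> exists2 g, A g & fgval g = w) -> size l <= #|` fset_set A|.
Proof.
move=> finA ul lA; rewrite -(size_map (@fgval bool)) uniq_leq_size// => w.
by move=> /lA[g Ag <-]; apply: map_f; rewrite in_fset_set// inE.
Qed.

End ReducedWordLists.

(** * Criteria for the lower and upper limits *)

Section Limits.
Local Open Scope ereal_scope.

(** Arbitrarily small values in every tail make all tail infima 0. *)
Lemma limn_einf_eq0 (R : realType) (u : (\bar R)^nat) : (forall n, 0 <= u n) ->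
  (forall (e : R) n, (0 < e)%R -> exists2 m, (n <= m)%N & u m <= e%:E) ->
  limn_einf u = 0.
Proof.
move=> u0 small; rewrite limn_einf_lim.
suff -> : einfs u = cst 0 by apply: cvg_lim => //; exact: cvg_cst.
apply/funext => n; apply/eqP; rewrite eq_le; apply/andP; split.
  apply/lee_addgt0Pr => e e0; rewrite add0e; have [m nm ume] := small e n e0.
  by apply: le_trans ume; apply: ereal_inf_lbound; exists m.
by apply: le_ereal_inf_tmp => _ [m _ <-].
Qed.

Lemma limn_esup_ge (R : realType) (u : (\bar R)^nat) (c : \bar R) :
  (forall n, exists2 m, (n <= m)%N & c <= u m) -> c <= limn_esup u.
Proof.
move=> large; rewrite limn_esup_lim; apply: lime_ge; first exact: is_cvg_esups.
apply: nearW => n; have [m nm cum] := large n.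
by apply: le_trans cum _; apply: ereal_sup_ubound; exists m.
Qed.

End Limits.

(** * Choice of the block lengths and the two density estimates *)

Local Open Scope ring_scope.

Theorem proposition6p1 (R : realType) :
  exists Lambda : set F2,
    [/\ is_subsemigroup Lambda,
        limn_einf (fun n : nat =>
          ((#|` fset_set (F2_ball n `&` Lambda)|%:R / #|` fset_set (F2_ball n)|%:R : R)%:E)) = 0%E
      & (0 < limn_esup (fun n : nat =>
          ((#|` fset_set (F2_ball n `&` Lambda)|%:R / #|` fset_set (F2_ball n)|%:R : R)%:E)))%E].
Proof.
(* The condition [0 < k] sits under the existential so that [choice] gives a function on all of
   [nat]. *)
have sparse_radius k : exists n, (0 < k)%N -> (k <= n)%N /\
    (k * count (good_word k) (ball_words n) <= 3 ^ n)%N.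
  case: (posnP k) => [->|k0]; first by exists 0%N.
  by have [n kn le3] := good_ball_sparse k k k0; exists n.
have [f fP] := choice sparse_radius.
(* The lengths start at 3, the least one covered by [many_blocks]. The next length is just beyond
   [f (a j)], so words within that radius use only blocks of length at most [a j]. *)
pose a j := iter j (fun k => (f k).+1) 3%N.
have a_ge j : (j.+3 <= a j)%N.
  elim: j => //= j IHj; rewrite ltnS (leq_trans IHj)//.
  by have [] := fP (a j) (leq_trans _ IHj).
have a_gt0 j : (0 < a j)%N by rewrite (leq_trans _ (a_ge j)).
have f_ge j : (a j <= f (a j))%N by have [] := fP _ (a_gt0 j).
have a_lt i j : (i < j)%N -> (f (a i) < a j)%N.
  elim: j => // j IHj; rewrite ltnS leq_eqVlt => /orP[/eqP->|/IHj]; first exact: ltnSn.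
  by move=> /ltn_trans; apply; rewrite ltnS.
pose L : pred nat := fun m => `[< exists j, m = a j >].
have L_le j m : L m -> (m <= f (a j))%N -> (m <= a j)%N.
  move=> /asboolP[i ->] ai; case: (ltngtP i j) => [/a_lt|/a_lt|->//].
    by move=> /ltnW; apply: leq_trans.
  by rewrite ltnNge ai.
have ball_fin n : finite_set (F2_ball n `&` block_semigroup L).
  exact: finite_setIl (F2_ball_finite n).
have ball_ge n : (3 ^ n <= #|` fset_set (F2_ball n)|)%N.
  have ub : (3 ^ n <= size (ball_words n))%N by have := size_ball_words n; lia.
  apply: leq_trans ub _; apply: card_fset_set_ge; [exact: F2_ball_finite|exact: uniq_ball_words|].
  move=> w; rewrite mem_ball_words => /andP[rw wn].
  by exists (FreeGroup rw) => //; rewrite F2_ball_sizeE.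
have ball_le n : (#|` fset_set (F2_ball n)| <= 2 * 3 ^ n)%N.
  rewrite -size_ball_words; apply/leqW/card_fset_set_le; first exact: F2_ball_finite.
  by move=> g; rewrite F2_ball_sizeE mem_ball_words fgvalP.
have sparse j : (a j * #|` fset_set (F2_ball (f (a j)) `&` block_semigroup L)|
    <= #|` fset_set (F2_ball (f (a j)))|)%N.
  apply: leq_trans (ball_ge _); apply: leq_trans (proj2 (fP _ (a_gt0 j))).
  rewrite leq_mul2l -size_filter card_fset_set_le ?orbT// => g [].
  rewrite F2_ball_sizeE mem_filter mem_ball_words fgvalP /= => sg [s [_ bs gE]].
  rewrite sg andbT gE (flatten_blocks_good L)// => u us.
  have /and4P[_ _ _ Lu] := allP bs u us.
  apply: L_le Lu _; apply: leq_trans sg; rewrite gE size_flatten sumnE big_map.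
  by rewrite (big_rem u us) leq_addr.
(* With a_j = n + 3, the ball has at most 2 * 3^(n+3) = 54 * 3^n elements, against 3^n blocks. *)
have dense j : (#|` fset_set (F2_ball (a j))|
    <= 54 * #|` fset_set (F2_ball (a j) `&` block_semigroup L)|)%N.
  have [n aE] : exists n, a j = n.+3.
    by have := a_ge j; case: (a j) => [|[|[|n]]] // _; exists n.
  have Ln : L n.+3 by apply/asboolP; exists j.
  have [l [ul sl /allP bl /allP szl]] := many_blocks L n Ln.
  rewrite aE (leq_trans (ball_le _))// !expnS !mulnA -sl leq_mul//.
  apply: card_fset_set_ge => // w wl.
  have /and4P[rw _ _ _] := bl _ wl.
  exists (FreeGroup rw) => //; split.
    by rewrite F2_ball_sizeE /= (eqP (szl _ wl)).
  by exists [:: w]; split; rewrite //= ?bl// cats0.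
have card_gt0 n : (0 < #|` fset_set (F2_ball n)|%:R :> R).
  by rewrite ltr0n (leq_trans _ (ball_ge n))// expn_gt0.
exists (block_semigroup L); split.
- split; last exact: block_semigroup_mul.
  (* Nonemptiness follows from the density bound at j = 0. *)
  have : (0 < #|` fset_set (F2_ball (a 0) `&` block_semigroup L)|)%N.
    rewrite -(ltn_pmul2l (isT : 0 < 54)%N) muln0 (leq_trans _ (dense 0%N))//.
    by rewrite (leq_trans _ (ball_ge _))// expn_gt0.
  by rewrite cardfs_gt0 => /fset0Pn[g]; rewrite in_fset_set// inE => -[_ Lg]; exists g.
- apply: limn_einf_eq0 => [n|e n e0]; first by rewrite lee_fin divr_ge0.
  (* This makes the radius at least [n] and [a j] larger than 1/e, so the density bound 1/a_j is
     below [e]. *)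
  pose j := maxn n (Num.truncn e^-1).+1.
  exists (f (a j)).
    by rewrite (leq_trans _ (f_ge j))// (leq_trans _ (a_ge j))// !leqW// leq_maxl.
  rewrite lee_fin ler_pdivrMr// -ler_pdivrMl//.
  have := sparse j; rewrite -(ler_nat R) natrM; apply: le_trans.
  rewrite ler_wpM2r// (le_trans (ltW (truncnS_gt _)))// ler_nat.
  by rewrite (leq_trans (leq_maxr n _))// (leq_trans _ (a_ge j))// !leqW.
- apply: lt_le_trans (limn_esup_ge _ _ (54%:R^-1)%:E _); first by rewrite lte_fin invr_gt0.
  move=> n; exists (a n); first by rewrite (leq_trans _ (a_ge n))// !leqW.
  rewrite lee_fin ler_pdivlMr// mulrC ler_pdivrMr// mulrC -natrM ler_nat.
  exact: dense.
Qed.
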